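(* As $n\to\infty$ through the even positive integers, $$\lim_{n\to\infty}\frac{1}{n}\exp(n)\sum_{j=0}^{n/2}(-1)^j\binom{n}{j}\left(\frac12\right)^{n}\left(1-\frac{2j}{n}\right)^{n+1}=\frac{1}{\sqrt{3}}.$$ *)

(* Defs.v *)
From HB Require Import structures.
From mathcomp Require Import all_boot all_order all_algebra.
From mathcomp Require Import all_classical all_reals all_analysis.

Set Implicit Arguments.
Unset Strict Implicit.
Unset Printing Implicit Defensive.

(* Main.v *)
Require Import Defs.
From HB Require Import structures.
From mathcomp Require Import all_boot all_order all_algebra.
From mathcomp Require Import all_classical all_reals all_analysis.
From mathcomp Require Import ring lra.
Set Implicit Arguments.
Unset Strict Implicit.
Unset Printing Implicit Defensive.

Import Order.TTheory GRing.Theory Num.Theory.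
Import numFieldNormedType.Exports.
Local Open Scope classical_set_scope.
Local Open Scope ring_scope.

(** Up to an explicit factor the sum is [E (S_n)_+], where [S_n] is a sum of [n]
    independent uniform variables on [[-1/2, 1/2]]: it is the [n]-th central
    difference at [0] of the truncated power [x_+ ^ (n+1) / (n+1)!].
    Lindeberg's replacement argument compares it with [E (a R_n)_+] for a simple
    random walk [R_n] and [a ^ 2 = 1 / 12], the two steps having the same variance;
    the error is [O (n ^ (3/8))] and hence negligible against [sqrt n].  For even
    [n] the walk gives a central binomial coefficient exactly, and together with
    the prefactor this leaves [2 a A_n / A_(n/2)] times [1 + 1/n], where
    [A_n = (n! e^n / (n^n sqrt n)) ^ 2] is monotone with
    [A_n / A_(n/2) -> 1]; neither the limit of [A_n] nor the Gaussian law is needed. *)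

(** * Two-point shift operators *)

(** One family contains the central difference and the random-walk step, so expansion, commutation
    and differentiation are proved once for both. *)
Definition shiftop (R : realType) (c d s : R) (f : R -> R) (x : R) : R :=
  c * f (x + s) + d * f (x - s).

(** Binomial theorem for the commuting translations by [s] and [- s]; the induction step is Pascal's
    rule. *)
Lemma iter_shiftopE (R : realType) (c d s : R) (n : nat) (f : R -> R) (x : R) :
  iter n (shiftop c d s) f x =
  \sum_(0 <= j < n.+1) 'C(n, j)%:R * c ^+ (n - j) * d ^+ j *
    f (x + (n%:R - 2 * j%:R) * s).
Proof.
elim: n f x => [|n IH] f x.
  by rewrite big_nat1 /= bin0 !expr0 !mul1r mulr0 subr0 mul0r addr0.
rewrite iterSr IH.
set g := fun j => f (x + (n.+1%:R - 2 * j%:R) * s).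
transitivity (\sum_(0 <= j < n.+2) 'C(n.+1, j)%:R * c ^+ (n.+1 - j) * d ^+ j * g j);
  last by [].
rewrite (@eq_big_nat _ _ _ _ _ _ (fun j => 'C(n, j)%:R * c ^+ (n.+1 - j) * d ^+ j * g j
    + 'C(n, j)%:R * c ^+ (n - j) * d ^+ j.+1 * g j.+1)); last first.
  move=> j /andP[_ jn]; rewrite /shiftop /g subSn // !exprS.
  rewrite (_ : x + (n%:R - 2 * j%:R) * s + s = x + (n.+1%:R - 2 * j%:R) * s); last first.
    by rewrite -natr1; ring.
  rewrite (_ : x + (n%:R - 2 * j%:R) * s - s = x + (n.+1%:R - 2 * j.+1%:R) * s); last first.
    by rewrite -!natr1; ring.
  by ring.
clearbody g; rewrite big_split /= big_nat_recl // [in RHS]big_nat_recl // -addrA; congr (_ + _).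
  by rewrite !bin0.
under [in RHS]eq_bigr do rewrite binS natrD !mulrDl subSS.
rewrite big_split /=; congr (_ + _).
rewrite [in RHS]big_nat_recr //= bin_small // !mul0r addr0.
by apply: eq_big_nat => j jn; rewrite subSS.
Qed.

Lemma shiftopB (R : realType) (c d s : R) (f g : R -> R) :
  shiftop c d s (fun x => f x - g x) =
  fun x => shiftop c d s f x - shiftop c d s g x.
Proof. by apply/funext => x; rewrite /shiftop; ring. Qed.

Lemma iter_shiftopB (R : realType) (c d s : R) (n : nat) (f g : R -> R) :
  iter n (shiftop c d s) (fun x => f x - g x) =
  fun x => iter n (shiftop c d s) f x - iter n (shiftop c d s) g x.
Proof. by elim: n => //= n ->; rewrite shiftopB. Qed.

(** * Towers of antiderivatives and Lindeberg replacement *)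

Lemma is_derive_shift (R : realType) (f df : R -> R) (s x : R) :
  (forall y : R, is_derive y 1 f (df y)) ->
  is_derive x 1 (fun y => f (y + s)) (df (x + s)).
Proof.
move=> fdf.
have ds : is_derive x 1 (fun y : R => y + s) 1.
  by rewrite -[X in is_derive _ _ _ X](addr0 1); apply: is_deriveD.
by have := @is_derive1_comp _ f (fun y => y + s) x _ _ (fdf _) ds; rewrite mulr1.
Qed.

Lemma is_derive_shiftop (R : realType) (c d s : R) (f df : R -> R) (x : R) :
  (forall y : R, is_derive y 1 f (df y)) ->
  is_derive x 1 (shiftop c d s f) (shiftop c d s df x).
Proof.
move=> fdf.
have h1 := is_derive_shift s x fdf.
have h2 := is_derive_shift (- s) x fdf.
by have := is_deriveD (is_deriveZ c h1) (is_deriveZ d h2).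
Qed.

Definition antiderivatives (R : realType) (H : nat -> R -> R) :=
  forall i (x : R), is_derive x 1 (H i.+1) (H i x).

Lemma antiderivatives_shiftop (R : realType) (c d s : R) (H : nat -> R -> R) :
  antiderivatives H -> antiderivatives (fun i => shiftop c d s (H i)).
Proof. by move=> dH i x; apply: is_derive_shiftop => y; exact: dH. Qed.

Lemma antiderivativesB (R : realType) (H K : nat -> R -> R) :
  antiderivatives H -> antiderivatives K ->
  antiderivatives (fun i x => H i x - K i x).
Proof.
by move=> dH dK i x; have := is_deriveB (dH i x) (dK i x).
Qed.

Definition cdiff (R : realType) : (R -> R) -> R -> R := shiftop 1 (-1) (1 / 2).

(** By the mean value theorem, the difference over an interval of length 1 is a value of [df]. *)
Lemma cdiff_bound (R : realType) (f df : R -> R) (M : R) :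
  (forall y : R, is_derive y 1 f (df y)) -> (forall y, `|df y| <= M) ->
  forall x, `|cdiff f x| <= M.
Proof.
move=> fdf dfM x; rewrite /cdiff /shiftop mul1r mulN1r.
have le : x - 1 / 2 <= x + 1 / 2 by lra.
have [|c _ ->] := @MVT_segment R f df _ _ le (fun y _ => fdf y).
  apply: continuous_subspaceT => y.
  by apply/differentiable_continuous/derivable1_diffP; case: (fdf y).
by rewrite (_ : _ - _ = 1) ?mulr1//; field.
Qed.

(** Each difference descends one level of the tower without enlarging the sup bound, as an average
    would. *)
Lemma iter_cdiff_bound (R : realType) (n : nat) (H : nat -> R -> R) (M : R) :
  antiderivatives H -> (forall y, `|H 0%N y| <= M) ->
  forall x, `|iter n (@cdiff R) (H n) x| <= M.
Proof.
elim: n H => [|n IH] H dH HM x; first exact: HM.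
rewrite iterSr; apply: (IH (fun i => cdiff (H i.+1))) => [|y].
  by apply: antiderivatives_shiftop => i; exact: dH.
by apply: cdiff_bound HM y => y; exact: dH.
Qed.

Definition average (R : realType) (a : R) : (R -> R) -> R -> R :=
  shiftop (1 / 2) (1 / 2) a.

Lemma average_bound (R : realType) (a : R) (f : R -> R) (M : R) :
  (forall y, `|f y| <= M) -> forall x, `|average a f x| <= M.
Proof.
move=> fM x; rewrite /average /shiftop.
have := fM (x + a); have := fM (x - a); rewrite !ler_norml => /andP[? ?] /andP[? ?].
by apply/andP; split; lra.
Qed.

Lemma iter_average_bound (R : realType) (a : R) (n : nat) (f : R -> R) (M : R) :
  (forall y, `|f y| <= M) -> forall x, `|iter n (average a) f x| <= M.
Proof. by move=> fM; elim: n => //= n; exact: average_bound. Qed.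

Lemma shiftopC (R : realType) (c d s c' d' s' : R) (f : R -> R) :
  shiftop c d s (shiftop c' d' s' f) = shiftop c' d' s' (shiftop c d s f).
Proof.
apply/funext => x; rewrite /shiftop.
rewrite (addrAC x s s') (addrAC x s (- s')) (addrAC x (- s) s') (addrAC x (- s) (- s')).
ring.
Qed.

(** Uniform steps are exchanged for walk steps one at a time. The operators commute and neither kind
    enlarges sup bounds, so each exchange costs at most [M]. *)
Lemma iter_cdiff_average (R : realType) (a : R) (n : nat) (H : nat -> R -> R)
    (M : R) :
  antiderivatives H ->
  (forall y, `|cdiff (H 1%N) y - average a (H 0%N) y| <= M) ->
  forall x, `|iter n (@cdiff R) (H n) x - iter n (average a) (H 0%N) x| <= n%:R * M.
Proof.
elim: n H => [|n IH] H dH HM x; first by rewrite subrr normr0 mul0r.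
rewrite !iterSr.
(* The defect of one exchange is itself a tower, so the remaining [n] differences can be applied to
   it. *)
pose K i y := cdiff (H i.+1) y - average a (H i) y.
have dK : antiderivatives K.
  apply: antiderivativesB; last exact: antiderivatives_shiftop.
  by apply: (@antiderivatives_shiftop _ _ _ _ (fun i => H i.+1)) => i; exact: dH.
have /= K1 := iter_cdiff_bound n dK HM x.
have /= K2 := IH (fun i => average a (H i)) _ _ x.
rewrite /K iter_shiftopB in K1.
(* The intermediate term has exactly one step exchanged; the rest is the induction hypothesis for
   the averaged tower. *)
rewrite -(subrKA (iter n (@cdiff R) (average a (H n)) x)) -natr1 mulrDl mul1r addrC.
apply: le_trans (ler_normD _ _) _; apply: lerD => //.
apply: K2 => [|y]; first exact: antiderivatives_shiftop.
rewrite (_ : _ - _ = average a (K 0%N) y); first exact: average_bound.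
by rewrite /K /cdiff /average shiftopC shiftopB.
Qed.

(** * Truncated powers *)

(** At [m = 0] this is the constant 1, not a step function; hence the towers below start at a
    positive exponent. *)
Definition trunc_power (R : realType) (m : nat) (x : R) : R :=
  Num.max x 0 ^+ m / m`!%:R.

Lemma trunc_power_ge0E (R : realType) (m : nat) (x : R) :
  0 <= x -> trunc_power m x = x ^+ m / m`!%:R.
Proof. by move=> x0; rewrite /trunc_power max_l. Qed.

Lemma trunc_power_le0E (R : realType) (m : nat) (x : R) :
  x <= 0 -> trunc_power m.+1 x = 0.
Proof. by move=> x0; rewrite /trunc_power max_r// expr0n mul0r. Qed.

Lemma is_derive_trunc_square (R : realType) (x : R) :
  is_derive x 1 (fun y : R => Num.max y 0 ^+ 2) (2 * Num.max x 0).
Proof.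
(* A quadratic remainder, uniform in [x], treats the kink at 0 together with all other points. *)
have bound (h : R) :
    `|Num.max (h + x) 0 ^+ 2 - Num.max x 0 ^+ 2 - h * (2 * Num.max x 0)| <= h ^+ 2.
  rewrite ler_norml; apply/andP.
  by case: (leP (h + x) 0); case: (leP x 0) => ? ?; split; nra.
have cv : h^-1 *: (Num.max (h *: 1 + x) 0 ^+ 2 - Num.max x 0 ^+ 2) @[h --> 0^']
    --> (2 * Num.max x 0).
  apply/cvgrPdist_le => e e0; near=> h.
  have h0 : h != 0 by near: h; exact: nbhs_dnbhs_neq.
  have he : `|h| <= e by near: h; apply: dnbhs0_le.
  rewrite [_ *: 1]mulr1 [_ *: _]mulrC.
  rewrite distrC -(@ler_pM2l _ `|h|) ?normr_gt0// -normrM mulrBr mulrCA mulfV// mulr1.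
  by apply: le_trans (bound h) _; rewrite -real_normK ?num_real// expr2 ler_wpM2l.
by split; [apply/cvg_ex; exists (2 * Num.max x 0) | exact/cvg_lim].
Unshelve. all: by end_near. Qed.

(** Confines the kink to the square, already differentiated, leaving a polynomial factor for the
    product rule. *)
Lemma max0_exprSS (R : realType) (m : nat) (x : R) :
  Num.max x 0 ^+ m.+2 = Num.max x 0 ^+ 2 * x ^+ m.
Proof.
case: (leP x 0) => x0; last by rewrite -exprD.
by rewrite !expr0n mul0r.
Qed.

Lemma antiderivatives_trunc_power (R : realType) (i : nat) :
  antiderivatives (fun m => @trunc_power R (i + m).+1).
Proof.
move=> m x; rewrite addnS; move: (i + m)%N => {i}m.
have := is_deriveZ (m.+2)`!%:R^-1
  (is_deriveM (is_derive_trunc_square x) (is_deriveX m (is_derive_id x 1))).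
rewrite !fctE.
set g := (X in is_derive _ _ X _); set d := (X in is_derive _ _ _ X).
have -> : g = trunc_power m.+2.
  by apply/funext => y; rewrite /g /trunc_power max0_exprSS mulrC.
rewrite (_ : d = trunc_power m.+1 x) //.
have sc (a b : R^o) : a *: b = (a : R) * b by [].
rewrite /d /trunc_power !sc mulr1 factS natrM invfM.
have m0 : m.+2%:R != 0 :> R by rewrite pnatr_eq0.
have m1 : (m.+1)`!%:R != 0 :> R by rewrite pnatr_eq0 -lt0n fact_gt0.
have [x0|x0] := leP x 0.
  by rewrite !expr0n /= !(mulr0, mul0r, addr0).
rewrite -natr1 in m0.
case: m g d m0 m1 => [|m] _ _ m0 m1 /=; first by rewrite !expr0; field.
rewrite !exprS -!natr1 in m0 *; field; exact/andP.
Qed.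

Lemma trunc_power_ge0 (R : realType) (m : nat) (x : R) : 0 <= trunc_power m x.
Proof. by rewrite divr_ge0 ?exprn_ge0 ?ler0n// le_max lexx orbT. Qed.

Lemma trunc_power_le (R : realType) (m : nat) (x b : R) :
  0 <= b -> x <= b -> trunc_power m x <= b ^+ m / m`!%:R.
Proof.
move=> b0 xb; rewrite ler_wpM2r ?invr_ge0 ?ler0n//.
by rewrite lerXn2r ?nnegrE ?le_max ?lexx ?orbT // ge_max xb.
Qed.

(** * Smoothing and the replacement error *)

(* The second difference of step [h] divided by [h ^+ 2] is convolution with a
   hat function, so it regularizes while commuting with all shift operators. *)
Definition smooth (R : realType) (h : R) (f : R -> R) : R -> R :=
  shiftop h^-1 (- h^-1) (h / 2) (shiftop h^-1 (- h^-1) (h / 2) f).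

Lemma smoothE (R : realType) (h : R) (f : R -> R) (x : R) : h != 0 ->
  smooth h f x = (f (x + h) - 2 * f x + f (x - h)) / h ^+ 2.
Proof.
move=> h0; rewrite /smooth /shiftop subrK addrK.
rewrite (_ : x + h / 2 + h / 2 = x + h); last by field.
rewrite (_ : x - h / 2 - h / 2 = x - h); last by field.
by field.
Qed.

Lemma smooth_bound (R : realType) (h : R) (f : R -> R) (M : R) : 0 < h ->
  (forall y, `|f y| <= M) -> forall x, `|smooth h f x| <= 4 * M / h ^+ 2.
Proof.
move=> h0 fM x; rewrite smoothE ?gt_eqF// normrM normfV.
rewrite (ger0_norm (exprn_ge0 _ (ltW h0))) ler_wpM2r ?invr_ge0 ?exprn_ge0 ?(ltW h0)//.
have := fM (x + h); have := fM (x - h); have := fM x.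
rewrite !ler_norml => /andP[? ?] /andP[? ?] /andP[? ?].
by apply/andP; split; lra.
Qed.

Lemma smoothB (R : realType) (h : R) (f g : R -> R) :
  smooth h (fun x => f x - g x) = fun x => smooth h f x - smooth h g x.
Proof. by rewrite /smooth !shiftopB. Qed.

Lemma shiftop_smooth (R : realType) (c d s h : R) (f : R -> R) :
  shiftop c d s (smooth h f) = smooth h (shiftop c d s f).
Proof. by rewrite /smooth !(shiftopC c). Qed.

(** The normalized second difference of [x ^+ 3 / 6] is exactly [x], so the two functions agree
    outside [(-h, h)]. Inside, every term is of order [h]; the constant is not sharp. *)
Lemma dist_smooth_trunc_power (R : realType) (h x : R) : 0 < h ->
  `|trunc_power 1 x - smooth h (trunc_power 3) x| <= 3 * h.
Proof.
move=> h0; have hn0 : h != 0 by rewrite gt_eqF.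
have fact3 : 3`!%:R = 6 :> R by [].
have fact_1 : 1`!%:R = 1 :> R by [].
rewrite smoothE//.
have [xh|xh] := leP h x.
  rewrite !trunc_power_ge0E; try lra.
  rewrite fact3 fact_1 (_ : _ - _ = 0) ?normr0; first by rewrite mulr_ge0// ltW.
  by field.
have [xh'|xh'] := leP x (- h).
  rewrite !trunc_power_le0E; try lra.
  by rewrite mulr0 !(subr0, addr0) mul0r subr0 normr0 mulr_ge0// ltW.
rewrite (@trunc_power_le0E _ _ (x - h)) ?addr0; last by lra.
have := trunc_power_ge0 1 x; have := @trunc_power_le _ 1 x h (ltW h0) (ltW xh).
have := trunc_power_ge0 3 x; have := @trunc_power_le _ 3 x h (ltW h0) (ltW xh).
have h20 : 0 <= 2 * h by lra.
have xhh : x + h <= 2 * h by lra.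
have := trunc_power_ge0 3 (x + h); have := trunc_power_le 3 h20 xhh.
rewrite fact3 fact_1 expr1 divr1.
move: (trunc_power 1 x) (trunc_power 3 x) (trunc_power 3 (x + h)) => u v w.
move=> w1 w0 v1 v0 u1 u0; have h3 : 0 < h ^+ 2 by rewrite exprn_gt0.
have : - h <= (w - 2 * v) / h ^+ 2 <= 2 * h.
  by rewrite ler_pdivlMr// ler_pdivrMr//; apply/andP; split; nra.
by move=> /andP[? ?]; rewrite ler_norml; apply/andP; split; lra.
Qed.

(* Both sides agree on cubics because [a ^+ 2] is the variance of the uniform
   law on a unit interval; hence the defect vanishes away from the knot. *)
Lemma cdiff_average_trunc_power (R : realType) (a x : R) :
  0 <= a -> a ^+ 2 = 1 / 12 ->
  `|cdiff (trunc_power 4) x - average a (trunc_power 3) x| <= 1.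
Proof.
move=> a0 a2; rewrite /cdiff /average /shiftop.
have ah : a <= 1 / 2 by nra.
have fact3 : 3`!%:R = 6 :> R by [].
have fact4 : 4`!%:R = 24 :> R by [].
have [xh|xh] := leP (1 / 2) x.
  rewrite !trunc_power_ge0E; try lra.
  rewrite fact3 fact4 (_ : _ - _ = x * (1 / 24 - a ^+ 2 / 2)); last by field.
  by rewrite a2 ler_norml; apply/andP; split; lra.
have [xh'|xh'] := leP x (- (1 / 2)).
  by rewrite !trunc_power_le0E; try lra; rewrite !mulr0 !addr0 subrr normr0 ler01.
have xh1 : x + 1 / 2 <= 1 by lra.
have xa1 : x + a <= 1 by lra.
have xa2 : x - a <= 1 by lra.
rewrite (@trunc_power_le0E _ _ (x - 1 / 2)); last by lra.
have := trunc_power_ge0 4 (x + 1 / 2); have := trunc_power_le 4 ler01 xh1.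
have := trunc_power_ge0 3 (x + a); have := trunc_power_le 3 ler01 xa1.
have := trunc_power_ge0 3 (x - a); have := trunc_power_le 3 ler01 xa2.
rewrite fact3 fact4 !expr1n.
move: (trunc_power 3 (x - a)) (trunc_power 3 (x + a)) (trunc_power 4 (x + 1 / 2)).
by move=> u v w; rewrite ler_norml => *; apply/andP; split; lra.
Qed.

(** Passing to the smoothed tower costs [3 * h] at each end. There one exchange has defect at most
    [4 / h ^+ 2]: smoothing multiplies the unit defect of the cubic level by at most that factor. *)
Lemma iter_cdiff_trunc_power (R : realType) (a h : R) (n : nat) (x : R) :
  0 <= a -> a ^+ 2 = 1 / 12 -> 0 < h ->
  `|iter n (@cdiff R) (trunc_power n.+1) x - iter n (average a) (trunc_power 1) x|
    <= 6 * h + 4 * n%:R / h ^+ 2.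
Proof.
move=> a0 a2 h0.
pose F i := @trunc_power R (0 + i).+1.
pose G i := smooth h (@trunc_power R (2 + i).+1).
have dF : antiderivatives F := antiderivatives_trunc_power 0.
have dG : antiderivatives G.
  apply: antiderivatives_shiftop; apply: antiderivatives_shiftop.
  exact: antiderivatives_trunc_power.
have FG y : `|F 0%N y - G 0%N y| <= 3 * h by exact: dist_smooth_trunc_power.
have := iter_cdiff_bound n (antiderivativesB dF dG) FG x.
have := iter_average_bound a n FG x.
have defect y : `|cdiff (G 1%N) y - average a (G 0%N) y| <= 4 * 1 / h ^+ 2.
  rewrite /cdiff /average !shiftop_smooth.
  rewrite (_ : _ - _ = smooth h (fun z => cdiff (trunc_power 4) z
     - average a (trunc_power 3) z) y); last by rewrite smoothB.
  by apply: smooth_bound => // z; exact: cdiff_average_trunc_power.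
have := iter_cdiff_average n dG defect x.
rewrite !iter_shiftopB /F /= !ler_norml.
rewrite (_ : n%:R * (4 * 1 / h ^+ 2) = 4 * n%:R / h ^+ 2); last by field; rewrite gt_eqF.
by move=> /andP[? ?] /andP[? ?] /andP[? ?]; apply/andP; split; lra.
Qed.

(** * Exact evaluation at 0 for an even number of steps *)

(** For [j > m] the argument is nonpositive and the truncated power vanishes, which cuts the
    binomial sum at half its range. *)
Lemma iter_shiftop_trunc_power (R : realType) (c d s : R) (m k : nat) : 0 <= s ->
  iter m.*2 (shiftop c d s) (trunc_power k.+1) 0 =
  \sum_(0 <= j < m.+1) 'C(m.*2, j)%:R * c ^+ (m.*2 - j) * d ^+ j *
    (((m.*2%:R - 2 * j%:R) * s) ^+ k.+1 / (k.+1)`!%:R).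
Proof.
move=> s0; rewrite iter_shiftopE (@big_cat_nat _ _ _ m.+1) //=; last first.
  by rewrite ltnS -addnn leq_addr.
rewrite [X in _ + X](_ : _ = 0) ?addr0.
  apply: eq_big_nat => j /andP[_ jm]; rewrite add0r trunc_power_ge0E//.
  by rewrite mulr_ge0// subr_ge0 -natrM ler_nat mul2n leq_double -ltnS.
rewrite big_nat_cond big1// => j /andP[/andP[mj _] _].
rewrite add0r trunc_power_le0E ?mulr0// mulr_le0_ge0// subr_le0 -natrM ler_nat.
by rewrite mul2n leq_double ltnW.
Qed.

(** The sum telescopes: [(n - 2j) C(n,j) = (j+1) C(n,j+1) - j C(n,j)]. *)
Lemma sum_binomial_centered (R : realType) (n k : nat) : (k <= n)%N ->
  \sum_(0 <= j < k.+1) 'C(n, j)%:R * (n%:R - 2 * j%:R) =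
  (n - k)%:R * 'C(n, k)%:R :> R.
Proof.
elim: k => [|k IH] kn; first by rewrite big_nat1 subn0; ring.
rewrite big_nat_recr //= IH ?(ltnW kn)// -natrM -mul_bin_left !natrM.
by rewrite natrB// -natr1; ring.
Qed.

Lemma iter_average_trunc_power (R : realType) (a : R) (m : nat) : 0 <= a ->
  iter m.*2 (average a) (trunc_power 1) 0 =
  (1 / 2) ^+ m.*2 * a * m%:R * 'C(m.*2, m)%:R.
Proof.
move=> a0; rewrite iter_shiftop_trunc_power//.
have mm : (m <= m.*2)%N by rewrite -addnn leq_addr.
have := sum_binomial_centered R mm.
rewrite (_ : m.*2 - m = m)%N => [bin|]; last by rewrite -addnn addnK.
rewrite -mulrA -bin mulr_sumr; apply: eq_big_nat => j /andP[_ jm].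
have -> : (1 / 2) ^+ m.*2 = (1 / 2) ^+ (m.*2 - j) * (1 / 2) ^+ j :> R.
  by rewrite -exprD subnK// (leq_trans _ mm).
by rewrite expr1 (_ : 1`!%:R = 1)//; field.
Qed.

(** Writing [1 - 2j/n] as [2/n] times the node [(n - 2j)/2] gives the power of [2/n]; the factorial
    undoes the normalization of [trunc_power]. *)
Lemma sum_cdiff_trunc_power (R : realType) (m : nat) : (0 < m)%N ->
  \sum_(0 <= j < m.+1) (-1) ^+ j * 'C(m.*2, j)%:R * (1 / 2) ^+ m.*2 *
       (1 - 2 * j%:R / m.*2%:R) ^+ (m.*2).+1 =
  (1 / 2) ^+ m.*2 * (2 / m.*2%:R) ^+ (m.*2).+1 * (m.*2.+1)`!%:R *
    iter m.*2 (@cdiff R) (trunc_power m.*2.+1) 0.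
Proof.
move=> m0; rewrite iter_shiftop_trunc_power; last by lra.
rewrite mulr_sumr; apply: eq_big_nat => j _; rewrite expr1n mulr1.
have n0 : m.*2%:R != 0 :> R by rewrite pnatr_eq0 double_eq0 -lt0n.
rewrite (_ : 1 - 2 * j%:R / m.*2%:R = 2 / m.*2%:R * ((m.*2%:R - 2 * j%:R) * (1 / 2)));
  last by field.
have f0 : (m.*2.+1)`!%:R != 0 :> R by rewrite pnatr_eq0 -lt0n fact_gt0.
rewrite [X in _ * X = _]exprMn; move: (_ ^+ _) (_ ^+ _) (_ ^+ _) (_ ^+ _).
by move: ((m.*2.+1)`!%:R) f0 => f f0 *; field.
Qed.

(** * Logarithm bounds and Stirling ratios *)

Lemma is_derive_ge0_le (R : realType) (f df : R -> R) (a b : R) : a <= b ->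
  (forall x : R, a <= x <= b -> is_derive x 1 f (df x)) ->
  (forall x, a <= x <= b -> 0 <= df x) -> f a <= f b.
Proof.
move=> ab fdf df0.
have [x xab|x|c cab fE] := @MVT_segment R f df _ _ ab.
- by apply: fdf; move: xab; rewrite in_itv /= => /andP[/ltW -> /ltW ->].
- apply: derivable_within_continuous x => x; rewrite in_itv /= => /fdf; by case.
- by rewrite -subr_ge0 fE mulr_ge0 ?subr_ge0 ?df0.
Qed.

(** Equality holds at 1, and the difference has derivative [(x - 1)^2 / (x (1 + x)^2)]. *)
Lemma ln_ge_harmonic (R : realType) (y : R) : 1 <= y -> 2 - 4 / (1 + y) <= ln y.
Proof.
move=> y1.
pose f := fun x : R => ln x + 4 * (1 + x)^-1.
suff : f 1 <= f y.
  rewrite /f ln1 (_ : 0 + 4 * (1 + 1)^-1 = 2); last by field.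
  by lra.
have df x : 1 <= x <= y -> is_derive x 1 f (x^-1 - 4 / (1 + x) ^+ 2).
  move=> /andP[x1 _].
  have x0 : 0 < x by lra.
  have x10 : 1 + x != 0 by rewrite gt_eqF //; lra.
  have d1 := is_derive1_ln x0.
  have d2 : is_derive x 1 (fun x : R => 1 + x) 1.
    by rewrite -[X in is_derive _ _ _ X](add0r 1); apply: is_deriveD.
  apply: (is_derive_eq (is_deriveD d1 (is_deriveZ 4 (is_deriveV x10 d2)))).
  by rewrite /GRing.scale /=; field; rewrite x10 gt_eqF.
apply: (is_derive_ge0_le y1 df) => x /andP[x1 _].
rewrite (_ : _ - _ = (x - 1) ^+ 2 / (x * (1 + x) ^+ 2)); last first.
  by field; apply/andP; split; rewrite gt_eqF//; lra.
by rewrite divr_ge0 ?sqr_ge0// mulr_ge0 ?sqr_ge0//; lra.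
Qed.

(** Equality holds at 1, and the difference has derivative [(1 - 1/x)^2 / 2]. *)
Lemma ln_le_half_subV (R : realType) (y : R) : 1 <= y -> ln y <= (y - y^-1) / 2.
Proof.
move=> y1.
pose f := fun x : R => 2^-1 * x - 2^-1 * x^-1 - ln x.
suff : f 1 <= f y.
  rewrite /f ln1 invr1 mulr1 subrr subr0.
  by lra.
have df x : 1 <= x <= y -> is_derive x 1 f ((1 + x^-2) / 2 - x^-1).
  move=> /andP[x1 _].
  have x0 : 0 < x by lra.
  have xn0 : x != 0 by rewrite gt_eqF.
  have did := is_derive_id x (1 : R).
  apply: (is_derive_eq (is_deriveB (is_deriveB (is_deriveZ 2^-1 did)
    (is_deriveZ 2^-1 (is_deriveV xn0 did))) (is_derive1_ln x0))).
  by rewrite /GRing.scale /=; field.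
apply: (is_derive_ge0_le y1 df) => x /andP[x1 _].
rewrite (_ : _ - _ = (1 - x^-1) ^+ 2 / 2); last first.
  by field; rewrite gt_eqF//; lra.
by rewrite divr_ge0 ?sqr_ge0.
Qed.

(** At [y = (k+1)/k] the lower bound on [ln y] is [2 / (2k+1)]. The upper one yields an excess
    [1 / (2k(k+1))], written as a difference so that it telescopes. *)
Lemma ln_succ_ratio_bounds (R : realType) (k : nat) : (0 < k)%N ->
  2 <= (2 * k%:R + 1) * ln (k.+1%:R / k%:R : R)
    <= 2 + (2 * k%:R)^-1 - (2 * k.+1%:R)^-1.
Proof.
move=> k0; have kp : 0 < k%:R :> R by rewrite ltr0n.
have y1 : 1 <= k.+1%:R / k%:R :> R by rewrite ler_pdivlMr// mul1r ler_nat.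
have := ln_ge_harmonic y1; have := ln_le_half_subV y1.
rewrite -natr1; move: (ln _) kp => l; move: (k%:R : R) => {y1 k0}k kp up lo.
have k1 : 0 < 2 * k + 1 by lra.
have n1 : k != 0 by rewrite gt_eqF.
have n2 : k + 1 != 0 by rewrite gt_eqF//; lra.
have n3 : 2 * k + 1 != 0 by rewrite gt_eqF.
move: lo up; rewrite -(ler_pM2l k1) => lo; rewrite -(ler_pM2l k1) => up.
apply/andP; split.
  apply: le_trans lo; rewrite le_eqVlt; apply/orP; left; apply/eqP; field.
  by rewrite n1 /= gt_eqF//; lra.
apply: le_trans up _; rewrite le_eqVlt; apply/orP; left; apply/eqP; field.
by rewrite n1 n2.
Qed.

(* Squared to avoid [sqrt n]: this is [(n! / (n ^ n * exp (- n) * sqrt n)) ^ 2]. *)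
Definition stirling_sqr (R : realType) (n : nat) : R :=
  n`!%:R ^+ 2 * expR n%:R ^+ 2 / n%:R ^+ (2 * n).+1.

Lemma stirling_sqr_gt0 (R : realType) (n : nat) : (0 < n)%N ->
  0 < stirling_sqr R n.
Proof.
by move=> n0; rewrite divr_gt0 ?mulr_gt0 ?exprn_gt0 ?expR_gt0 ?ltr0n ?fact_gt0.
Qed.

Lemma stirling_sqrS (R : realType) (k : nat) : (0 < k)%N ->
  stirling_sqr R k.+1 =
  stirling_sqr R k * expR (2 - (2 * k%:R + 1) * ln (k.+1%:R / k%:R)).
Proof.
move=> k0; have kp : 0 < k%:R :> R by rewrite ltr0n.
have yp : 0 < k.+1%:R / k%:R :> R by rewrite divr_gt0.
rewrite expRB -[2 * k%:R + 1](_ : (2 * k).+1%:R = _); last by rewrite -natr1 natrM.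
rewrite expRM_natl lnK ?posrE// /stirling_sqr expr_div_n factS natrM.
rewrite -[in expR k.+1%:R]natr1 expRD -[in expR 2](_ : 1 + 1 = 2 :> R)// expRD.
have n1 : k%:R != 0 :> R by rewrite gt_eqF.
have n2 : k.+1%:R != 0 :> R by rewrite pnatr_eq0.
rewrite (_ : (2 * k.+1).+1 = (2 * k).+1 + 2)%N; last by rewrite mulnS addnC.
rewrite exprD.
have := expf_neq0 (2 * k).+1 n1; have := expf_neq0 (2 * k).+1 n2.
move: (k%:R ^+ _) (k.+1%:R ^+ (2 * k).+1) => u v v0 u0.
move: (k.+1%:R : R) n2 (k`!%:R : R) => w n2 f; field; by rewrite ?v0 ?u0 ?n2.
Qed.

(** So [A_k] is nonincreasing while [A_k exp(-1/(2k))] is nondecreasing. *)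
Lemma stirling_sqr_step (R : realType) (k : nat) : (0 < k)%N ->
  stirling_sqr R k * expR ((2 * k.+1%:R)^-1 - (2 * k%:R)^-1) <= stirling_sqr R k.+1
    <= stirling_sqr R k.
Proof.
move=> k0; rewrite stirling_sqrS//; have A0 := stirling_sqr_gt0 R k0.
have /andP[lo up] := ln_succ_ratio_bounds R k0.
move: lo up; move: (_ * ln _) => l lo up.
set u := (2 * k%:R)^-1 in up *; set v := (2 * k.+1%:R)^-1 in up *.
apply/andP; split; first by rewrite ler_pM2l// ler_expR; clearbody u v; lra.
by rewrite ger_pMr// expR_le1; lra.
Qed.

Lemma stirling_sqr_bounds (R : realType) (m n : nat) : (0 < m <= n)%N ->
  stirling_sqr R m * expR ((2 * n%:R)^-1 - (2 * m%:R)^-1) <= stirling_sqr R n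
    <= stirling_sqr R m.
Proof.
move=> /andP[m0]; elim: n => [|n IH].
  by rewrite leqn0 => /eqP ->; rewrite subrr expR0 mulr1 lexx.
rewrite leq_eqVlt => /predU1P[<-|]; first by rewrite subrr expR0 mulr1 lexx.
rewrite ltnS => mn; have /andP[IH1 IH2] := IH mn.
have /andP[s1 s2] := stirling_sqr_step R (leq_trans m0 mn).
rewrite (le_trans s2 IH2) andbT (le_trans _ s1)//.
rewrite -(subrKA (2 * n%:R)^-1) addrC expRD mulrA ler_wpM2r// expR_ge0//.
Qed.

(** Since [n! C(n,m) = (n!/m!)^2] for [n = 2m], the squared Stirling quotients appear directly,
    without square roots. *)
Lemma stirling_sqr_half (R : realType) (m : nat) : (0 < m)%N ->
  m.*2`!%:R * expR m.*2%:R * 'C(m.*2, m)%:R / (m.*2%:R ^+ m.*2 * 2 ^+ m.*2) =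
  2 * (stirling_sqr R m.*2 / stirling_sqr R m).
Proof.
move=> m0; have mm : (m <= m.*2)%N by rewrite -addnn leq_addr.
have mp : m%:R != 0 :> R by rewrite pnatr_eq0 -lt0n.
have fp : m`!%:R != 0 :> R by rewrite pnatr_eq0 -lt0n fact_gt0.
have ep : expR m%:R != 0 :> R by rewrite gt_eqF ?expR_gt0.
have := bin_fact mm; rewrite (_ : m.*2 - m = m)%N; last by rewrite -addnn addnK.
move=> /(congr1 (fun k => k%:R : R)); rewrite !natrM => fE.
rewrite /stirling_sqr -fE (_ : m.*2%:R = 2 * m%:R); last by rewrite -mul2n natrM.
rewrite expRM_natl !mul2n -!addnn !(exprS _ (_ + _)) !exprD !exprMn.
have tp : 2 ^+ m != 0 :> R by rewrite expf_neq0.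
have mmp : m%:R ^+ m != 0 :> R by rewrite expf_neq0.
move: (2 ^+ m) (m%:R ^+ m) tp mmp ('C(_, _)%:R : R) => t u t0 u0 b.
by field; rewrite mp fp ep t0 u0.
Qed.

(** * Quantitative estimate and passage to the limit *)

(** Here [p] is [n ^ (-1/8)], so that every scale involved is an integer power of [p]. The prefactor
    is of order [p ^+ 4] and the replacement error of order [p ^- 3], leaving one factor [p]. *)
Lemma dist_normalized_cdiff (R : realType) (a p : R) (m : nat) :
  (0 < m)%N -> 0 <= a -> a ^+ 2 = 1 / 12 -> 0 < p -> p ^+ 8 = (m.*2%:R)^-1 ->
  `|2 * (m.*2%:R + 1) / m.*2%:R * (m.*2`!%:R * expR m.*2%:R / m.*2%:R ^+ m.*2.+1) *
    iter m.*2 (@cdiff R) (trunc_power m.*2.+1) 0 - 2 * a| <= (40 * expR 1 + 2 * a) * p.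
Proof.
move=> m0 a0 a2 p0; set n := m.*2 => p8.
have n0 : (0 < n)%N by rewrite double_gt0.
have np : 0 < n%:R :> R by rewrite ltr0n.
have nn : n%:R != 0 :> R by rewrite gt_eqF.
have p1 : p <= 1.
  by rewrite -(@expr_le1 _ 8) ?(ltW p0)// p8 invf_le1// ler1n.
set q := _ * (_ / _ ^+ n.+1); set U := iter _ _ _ _.
have q0 : 0 <= q.
  by rewrite /q !mulr_ge0 ?invr_ge0 ?exprn_ge0 ?ler0n ?expR_ge0 ?addr_ge0.
(* Monotonicity from [A_1 = e^2]. *)
have A1 : stirling_sqr R n <= expR 1 ^+ 2.
  have /andP[_] := @stirling_sqr_bounds R 1 n n0.
  by move=> /le_trans -> //; rewrite /stirling_sqr (_ : 1`!%:R = 1)// !expr1n mul1r divr1.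
have q2 : q ^+ 2 = 4 * (1 + n%:R^-1) ^+ 2 * n%:R^-1 * stirling_sqr R n.
  rewrite /q /stirling_sqr !(mul2n, exprS) -addnn exprD.
  have := expf_neq0 n nn; move: (n%:R ^+ n) => u u0; field.
  by rewrite u0 nn.
have nv1 : n%:R^-1 <= 1 :> R by rewrite invf_le1// ler1n.
have qle : q <= 4 * expR 1 * p ^+ 4.
  have e0 := expR_gt0 (1 : R).
  rewrite -(@ler_pXn2r _ 2) ?nnegrE ?mulr_ge0 ?exprn_ge0 ?(ltW p0) ?(ltW e0)//.
  rewrite q2 2!exprMn -exprM p8.
  have v0 : 0 <= n%:R^-1 :> R by rewrite invr_ge0 ltW.
  have v2 : (1 + n%:R^-1) ^+ 2 <= 4 :> R by nra.
  rewrite (_ : 4 ^+ 2 * _ * _ = 4 * 4 * n%:R^-1 * expR 1 ^+ 2); last by ring.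
  apply: ler_pM A1; first by rewrite !mulr_ge0 ?sqr_ge0.
  by rewrite ltW ?stirling_sqr_gt0.
  by rewrite ler_wpM2r// ler_wpM2l.
(* Smoothing scale [n ^ (3/8)]: any exponent strictly between 1/4 and 1/2 would do. *)
have h0 : 0 < p ^- 3 by rewrite invr_gt0 exprn_gt0.
have := iter_cdiff_trunc_power n 0 a0 a2 h0.
rewrite (_ : n%:R = p ^- 8); last by rewrite p8 invrK.
rewrite -/U iter_average_trunc_power// -/n.
set B := _ * 'C(n, m)%:R => UB.
have UB' : `|U - B| <= 10 * p ^- 3.
  apply: le_trans UB _.
  rewrite (_ : 4 * _ / _ = 4 * p ^- 2); last by field; rewrite gt_eqF.
  rewrite (_ : 10 * p ^- 3 = 6 * p ^- 3 + 4 * p ^- 3); last by ring.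
  by rewrite lerD2l ler_wpM2l// lef_pV2 ?posrE ?exprn_gt0// ler_wiXn2l// ltW.
have qUB : `|q * U - q * B| <= 40 * expR 1 * p.
  rewrite -mulrBr normrM (ger0_norm q0).
  apply: le_trans (ler_pM _ _ qle UB') _ => //.
  rewrite le_eqVlt; apply/orP; left; apply/eqP; field; by rewrite gt_eqF.
have qB : q * B = 2 * a * ((1 + n%:R^-1) * (stirling_sqr R n / stirling_sqr R m)).
  transitivity (a * (1 + n%:R^-1) * (2 * (stirling_sqr R n / stirling_sqr R m))); last by ring.
  rewrite -stirling_sqr_half// -/n /q /B exprS expr_div_n expr1n.
  rewrite (_ : m%:R = n%:R / 2); last by rewrite /n -mul2n natrM; field.
  have := expf_neq0 n nn; have t0 : 2 ^+ n != 0 :> R by rewrite expf_neq0.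
  move: (n%:R ^+ n) (2 ^+ n) t0 ('C(_, _)%:R : R) => u t t0 b u0; field.
  by rewrite t0 u0 nn.
(* As [2m = n], the exponent in the lower bound is [1/(2n) - 1/n], which is at least [-1/n]. *)
have r_bounds : 1 - n%:R^-1 <= stirling_sqr R n / stirling_sqr R m <= 1.
  have mn : (0 < m <= n)%N by rewrite m0 /n -addnn leq_addr.
  have /andP[lo up] := stirling_sqr_bounds R mn.
  have Am := stirling_sqr_gt0 R m0.
  rewrite ler_pdivrMr// mul1r up andbT ler_pdivlMr// mulrC.
  apply: le_trans lo; rewrite ler_wpM2l ?(ltW Am)//.
  apply: le_trans (expR_ge1Dx _).
  rewrite (_ : 2 * m%:R = n%:R); last by rewrite /n -mul2n natrM.
  have : 0 <= (2 * n%:R)^-1 :> R by rewrite invr_ge0 mulr_ge0.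
  move: (_^-1) (_^-1) => *; lra.
have qBa : `|q * B - 2 * a| <= 2 * a * p.
  rewrite qB; move: r_bounds; move: (stirling_sqr R n / _) => r /andP[r1 r2].
  have pp : n%:R^-1 <= p by rewrite -p8 ler_iXnr// ltW.
  rewrite -[X in _ - X]mulr1 -mulrBr normrM ger0_norm ?mulr_ge0//.
  rewrite ler_wpM2l ?mulr_ge0//; apply: le_trans pp.
  have v0 : 0 <= n%:R^-1 :> R by rewrite invr_ge0 ltW.
  (* With [v = 1/n], the product [(1 + v) r] lies between [1 - v^2] and [1 + v]. *)
  by move: (n%:R^-1) v0 nv1 r1 => v *; rewrite ler_norml; apply/andP; split; nra.
have -> : q * U - 2 * a = (q * U - q * B) + (q * B - 2 * a) by ring.
by rewrite (mulrDl (40 * _)); apply: le_trans (ler_normD _ _) _; exact: lerD.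
Qed.

Theorem mainTheorem2 (R : realType) :
  (fun n : nat =>
     1 / n%:R * expR n%:R *
     \sum_(0 <= j < n./2.+1)
       (-1) ^+ j * 'C(n, j)%:R * (1 / 2) ^+ n *
       (1 - 2 * j%:R / n%:R) ^+ n.+1 : R)
    @ within [set n : nat | (0 < n)%N /\ ~~ odd n] \oo
  --> (1 / Num.sqrt 3 : R).
Proof.
have s3 : Num.sqrt 3 ^+ 2 = 3 :> R by rewrite sqr_sqrtr.
have s0 : 0 < Num.sqrt 3 :> R by rewrite sqrtr_gt0.
(* The standard deviation of the uniform law on a unit interval; the limit is [2 * a]. *)
pose a : R := 1 / (2 * Num.sqrt 3).
have a0 : 0 <= a by rewrite divr_ge0 ?mulr_ge0 ?(ltW s0).
have a2 : a ^+ 2 = 1 / 12 by rewrite expr_div_n exprMn s3; field.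
have -> : 1 / Num.sqrt 3 = 2 * a :> R by rewrite /a; field; rewrite gt_eqF.
pose p n : R := Num.sqrt (Num.sqrt (Num.sqrt n%:R^-1)).
have p_cvg : p n @[n --> \oo] --> 0.
  have sqrt_cvg0 (u : nat -> R) : u n @[n --> \oo] --> 0 ->
      Num.sqrt (u n) @[n --> \oo] --> 0.
    move=> u0; rewrite -[0]sqrtr0.
    exact: (@continuous_cvg _ _ _ _ _ u Num.sqrt 0 (@sqrt_continuous R 0) u0).
  do 3 apply: (sqrt_cvg0 (fun _ => _)).
  (* The shift turns [1/n] into the harmonic sequence [1/(n+1)]. *)
  by rewrite -cvg_shiftS; exact: cvg_harmonic.
have Cp_cvg : (40 * expR 1 + 2 * a) * p n @[n --> \oo] --> 0.
  by rewrite -[0](mulr0 (40 * expR 1 + 2 * a)); apply: cvgMr.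
apply/cvgrPdist_le => e e0.
have /cvgrPdist_le/(_ _ e0) := Cp_cvg.
apply: filterS => n; rewrite sub0r normrN => le_e [n_gt0 n_even].
apply: le_trans le_e; apply: le_trans (ler_norm _).
have nE : n = n./2.*2 by rewrite -[LHS]odd_double_half (negbTE n_even).
move: n_gt0; rewrite nE; move: n./2 => {n n_even nE} m; rewrite double_gt0 => m0.
have n0 : 0 < m.*2%:R :> R by rewrite ltr0n double_gt0.
have p0 : 0 < p m.*2 by rewrite !sqrtr_gt0 invr_gt0.
have p8 : p m.*2 ^+ 8 = (m.*2%:R)^-1.
  rewrite (exprM _ 2 4) sqr_sqrtr ?sqrtr_ge0// (exprM _ 2 2).
  by rewrite !sqr_sqrtr ?sqrtr_ge0// invr_ge0 ltW.
have := dist_normalized_cdiff m0 a0 a2 p0 p8.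
rewrite distrC; congr (`| _ - _ | <= _).
rewrite doubleK sum_cdiff_trunc_power//; move: (iter _ _ _ _) => U.
have t0 : 2 ^+ m.*2 != 0 :> R by rewrite expf_neq0.
have nn : m.*2%:R != 0 :> R by rewrite gt_eqF.
rewrite factS natrM -(natr1 m.*2) !expr_div_n !exprS expr1n.
have := expf_neq0 m.*2 nn.
move: (m.*2%:R ^+ _) (2 ^+ _) (expR _) ((m.*2)`!%:R : R) t0 nn.
move: (m.*2%:R : R) => N u t x f t0 N0 u0.
field.
by rewrite u0 t0 N0.
Qed.
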